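(* Let $\Delta$ be a simplicial complex with vertex set $\{x_1,\dots,x_n\}$ and let $s_1,\dots,s_n$ be positive integers. Then $\Delta$ is strongly shellable if and only if its $(s_1,\dots,s_n)$-expansion $\Delta^{(s_1,\dots,s_n)}$ is strongly shellable.
   Context: A simplicial complex is a finite family of subsets of a vertex set closed under taking subsets; $\mathcal{F}(\Delta)$ is its set of facets. A linear order $F_1,\dots,F_t$ of $\mathcal{F}(\Delta)$ is a strong shelling order if for every $1\le i<j\le t$ there exists $k$ with $1\le k<j$ such that $|F_j\setminus F_k|=1$, $F_j\setminus F_k\subseteq F_j\setminus F_i$, and $F_k\setminus F_j\subseteq F_i$; $\Delta$ is strongly shellable if such an order exists. The $(s_1,\dots,s_n)$-expansion $\Delta^{(s_1,\dots,s_n)}$ is the simplicial complex with vertex set $\{x_{i,j}\mid 1\le i\le n,\ 1\le j\le s_i\}$ whose facet set is $\{\{x_{i_1,r_1},\dots,x_{i_t,r_t}\}\mid \{x_{i_1},\dots,x_{i_t}\}\in\mathcal{F}(\Delta),\ (r_1,\dots,r_t)\in[s_{i_1}]\times\cdots\times[s_{i_t}]\}$. *)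

(* Defs.v *)
From mathcomp Require Import all_boot.

Set Implicit Arguments.
Unset Strict Implicit.
Unset Printing Implicit Defensive.

(* Neither nonemptiness nor {x} \in faces for every vertex x is required. *)
Record simplicial_complex (V : finType) := SimplicialComplex {
  faces :> {set {set V}};
  faces_closed : forall F G : {set V}, F \in faces -> G \subset F -> G \in faces
}.

Definition facets (V : finType) (D : simplicial_complex V) : {set {set V}} :=
  [set F | maxset (fun G => G \in faces D) F].

(* A linear order of the facets is a duplicate-free enumeration, with
   positions counted from 0. *)
Definition strong_shelling_order (V : finType) (D : simplicial_complex V)
    (Fs : seq {set V}) : Prop :=
  let F := nth set0 Fs in
  [/\ uniq Fs,
      Fs =i facets D
    & forall i j : nat, i < j < size Fs ->
        exists k : nat,
          [/\ k < j,
              #|F j :\: F k| = 1,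
              F j :\: F k \subset F j :\: F i
            & F k :\: F j \subset F i]].

Definition strongly_shellable (V : finType) (D : simplicial_complex V) : Prop :=
  exists Fs : seq {set V}, strong_shelling_order D Fs.

Section Expansion.

Variables (n : nat) (s : 'I_n -> nat).

(* The vertex x_{i,j} is the dependent pair of i : 'I_n and j : 'I_(s i). *)
Definition expansion_vertex : finType := {i : 'I_n & 'I_(s i)}.

(* { x_{i, r i} | i in F }.  The choice r is total on 'I_n; as all the s i are
   positive where this is used, every choice on F extends to such an r. *)
Definition lift_face (r : {dffun forall i : 'I_n, 'I_(s i)}) (F : {set 'I_n}) :
    {set expansion_vertex} :=
  [set Tagged (fun i => 'I_(s i)) (r i) | i in F].

Variable D : simplicial_complex 'I_n.

Definition expansion_facets : {set {set expansion_vertex}} :=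
  [set H | [exists F in facets D, exists r, H == lift_face r F]].

Definition expansion_faces : {set {set expansion_vertex}} :=
  [set G : {set expansion_vertex} | [exists H in expansion_facets, G \subset H]].

Lemma expansion_faces_closed (F G : {set expansion_vertex}) :
  F \in expansion_faces -> G \subset F -> G \in expansion_faces.
Proof.
rewrite !inE => /existsP[H /andP[HE FH]] GF.
by apply/existsP; exists H; rewrite HE (subset_trans GF FH).
Qed.

Definition expansion : simplicial_complex expansion_vertex :=
  SimplicialComplex expansion_faces_closed.

Lemma lift_face_inj_subset r r' (F G : {set 'I_n}) :
  lift_face r F \subset lift_face r' G ->
  F \subset G /\ {in F, forall i, r i = r' i}.
Proof.
move=> sub.
have key i : i \in F -> i \in G /\ r i = r' i.
  move=> iF.
  have /(subsetP sub)/imsetP[j jG e] :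
    Tagged (fun i => 'I_(s i)) (r i) \in lift_face r F by apply: imset_f.
  have ij : i = j := congr1 tag e.
  by subst j; split=> //; apply: eq_from_Tagged e.
by split=> [|i iF]; [apply/subsetP=> i /key[] | case: (key i iF)].
Qed.

(* The expansion is generated by the prescribed facets; they are exactly its
   maximal faces. *)
Lemma facets_expansion : facets expansion = expansion_facets.
Proof.
have faceE H : H \in expansion_facets -> H \in expansion_faces.
  by move=> HE; rewrite inE; apply/existsP; exists H; rewrite HE subxx.
apply/setP=> H; apply/idP/idP.
  rewrite inE => /maxsetP[]; rewrite /= inE => /existsP[K /andP[KE HK]] Hmax.
  by rewrite -(Hmax K (faceE K KE) HK).
move=> HE; rewrite inE; apply/maxsetP; split; first exact: faceE.
move=> K /=; rewrite inE => /existsP[L /andP[LE KL]] HK.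
suff eHL : H = L by apply/eqP; rewrite eqEsubset HK andbT eHL.
have HL := subset_trans HK KL.
move: HE LE HL; rewrite !inE.
move=> /existsP[F /andP[FD /existsP[r /eqP->]]].
move=> /existsP[G /andP[GD /existsP[r' /eqP->]]].
move=> /lift_face_inj_subset[FG err'].
have eFG : G = F.
  move: FD GD; rewrite !inE => /maxsetP[_ Fmax] /maxsetp GD.
  exact: Fmax.
by rewrite eFG; apply: eq_in_imset => i iF; rewrite err'.
Qed.

End Expansion.

(* Main.v *)
(** Strong shellability is equivalent to the existence of a (not necessarily
    injective) ranking of the facets in which every pair of facets admits an
    exchange facet of strictly smaller rank than the larger one.  If [Delta]
    is ranked, rank the facet [lift_face r F] of the expansion first by the
    rank of [F], then by the sum of the second indices of its vertices.
    Conversely, an exchange facet for [H] and [H'] is contained in the union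
    of [H] and [H'], so the facets of the expansion supported on one fixed
    copy of the vertices of [Delta] inherit the exchange property. *)

Require Import Defs.
From mathcomp Require Import all_boot.

Set Implicit Arguments.
Unset Strict Implicit.
Unset Printing Implicit Defensive.

(** [F] is the earlier facet, [G] the later one, and [K] the facet reached from [G] by an exchange
    towards [F]. *)
Definition exchange (V : finType) (F G K : {set V}) : Prop :=
  [/\ #|G :\: K| = 1, G :\: K \subset G :\: F & K :\: G \subset F].

Definition shelling_rank (V : finType) (D : simplicial_complex V)
    (rk : {set V} -> nat) : Prop :=
  {in facets D &, forall F G, F != G -> rk F <= rk G ->
    exists K, [/\ K \in facets D, rk K < rk G & exchange F G K]}.

(** Positions in a shelling order form a rank. Conversely, sorting the facets by rank gives a
    shelling order, however ties are broken: the exchange condition covers [rk F = rk G] in both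
    directions, and [K] has strictly smaller rank than [G], so it precedes [G]. *)
Lemma strongly_shellableP (V : finType) (D : simplicial_complex V) :
  strongly_shellable D <-> exists rk, shelling_rank D rk.
Proof.
split=> [[Fs [uFs eFs shFs]] | [rk rkP]].
  exists (index^~ Fs) => F G; rewrite -!eFs => FFs GFs neFG.
  rewrite leq_eqVlt => /orP[/eqP e | ltFG].
    by case/eqP: neFG; rewrite -(nth_index set0 FFs) e nth_index.
  have ltG : index G Fs < size Fs by rewrite index_mem.
  have [|k [ltk]] := shFs (index F Fs) (index G Fs); first by rewrite ltFG ltG.
  rewrite !nth_index // => *; exists (nth set0 Fs k); split=> //.
    by rewrite -eFs mem_nth // (ltn_trans ltk).
  by rewrite index_uniq // (ltn_trans ltk).
pose leR F G := rk F <= rk G.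
have leR_total : total leR by move=> F G; apply: leq_total.
have leR_trans : transitive leR by move=> F G H; apply: leq_trans.
pose Fs := sort leR (enum (facets D)).
have uFs : uniq Fs by rewrite sort_uniq enum_uniq.
have eFs : Fs =i facets D by move=> F; rewrite mem_sort mem_enum.
have monoFs i j : i < size Fs -> j < size Fs -> i <= j ->
    rk (nth set0 Fs i) <= rk (nth set0 Fs j).
  move=> ? ? ?; have := sort_sorted leR_total (enum (facets D)).
  move/(sorted_leq_nth leR_trans (fun F => leqnn (rk F)) set0).
  exact.
exists Fs; split=> // i j /andP[ltij ltj].
have lti := ltn_trans ltij ltj.
have [||||K [KD ltK [*]]] := rkP (nth set0 Fs i) (nth set0 Fs j).
- by rewrite -eFs mem_nth.
- by rewrite -eFs mem_nth.
- by rewrite nth_uniq // ltn_eqF.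
- by apply: monoFs => //; apply: ltnW.
have KFs : K \in Fs by rewrite eFs.
exists (index K Fs); rewrite nth_index //; split=> //.
(* If [K] stood at position [j] or later, sortedness would make its rank at least that of the facet
   at [j]. *)
rewrite ltnNge; apply/negP=> /monoFs; rewrite ltj index_mem nth_index // KFs.
by move/(_ isT isT); rewrite leqNgt ltK.
Qed.

Section LiftFace.

Variables (n : nat) (s : 'I_n -> nat).

Local Notation choice_fun := {dffun forall i : 'I_n, 'I_(s i)}.
Local Notation vertex := (expansion_vertex s).
Local Notation vtx := (Tagged (fun i : 'I_n => 'I_(s i))).
Implicit Types (r : choice_fun) (F G K : {set 'I_n}) (H : {set vertex}).

Lemma vtx_inj r : injective (fun i => vtx (r i)).
Proof. by move=> i j /(congr1 tag). Qed.

Lemma mem_lift_face r F (v : vertex) :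
  (v \in lift_face r F) = (tag v \in F) && (v == vtx (r (tag v))).
Proof.
apply/imsetP/andP=> [[i iF ->] | [vF /eqP ev]]; first by rewrite /= eqxx.
by exists (tag v).
Qed.

Lemma mem_lift_face_vtx r r' F i :
  (vtx (r i) \in lift_face r' F) = (i \in F) && (r i == r' i).
Proof. by rewrite mem_lift_face eq_Tagged. Qed.

Lemma card_lift_face r F : #|lift_face r F| = #|F|.
Proof. exact/card_imset/vtx_inj. Qed.

Lemma lift_faceS r F G : (lift_face r F \subset lift_face r G) = (F \subset G).
Proof.
apply/idP/idP=> [/lift_face_inj_subset[] // | FG]; exact: imsetS.
Qed.

Lemma eq_lift_face r r' F : {in F, forall i, r i = r' i} ->
  lift_face r F = lift_face r' F.
Proof. by move=> err'; apply: eq_in_imset => i iF; rewrite err'. Qed.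

(** Vertices over [G :\: K] survive whatever [r'] is; those over [G :&: K] are removed because the
    two choices agree there. *)
Lemma lift_faceD r r' G K : {in G :&: K, forall i, r i = r' i} ->
  lift_face r G :\: lift_face r' K = lift_face r (G :\: K).
Proof.
move=> err'; apply/setP=> v; rewrite inE !mem_lift_face inE.
have [/eqP vG | _] := boolP (v == vtx (r (tag v))); last by rewrite !andbF.
have [/= iG | _] := boolP (tag v \in G); last by rewrite /= !andbF.
have [/= iK | //] := boolP (tag v \in K).
by rewrite -(err' (tag v)) ?inE ?iG // -vG eqxx.
Qed.

Lemma tag_lift_face r F : [set tag v | v in lift_face r F] = F.
Proof. by rewrite -imset_comp; apply: imset_id. Qed.

Definition weight H := \sum_(v in H) tagged v.

Lemma weight_lift_face r F : weight (lift_face r F) = \sum_(i in F) r i.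
Proof. by rewrite /weight big_imset //= => i j _ _; apply: vtx_inj. Qed.

Definition merge_choice G r r' : choice_fun :=
  [ffun i => if i \in G then r i else r' i].

(** [K] copies the choice of [G] on [G] and that of [F] elsewhere. Hence both set differences are
    lifts of the differences of the bases, and the vertices over [K :\: G] lie in the lift of
    [F]. *)
Lemma exchange_lift_face_base r r' F G K : exchange F G K ->
  exchange (lift_face r F) (lift_face r' G)
           (lift_face (merge_choice G r' r) K).
Proof.
case=> cGK sGK sKG.
have eGK : lift_face r' G :\: lift_face (merge_choice G r' r) K
    = lift_face r' (G :\: K).
  by apply: lift_faceD => i; rewrite inE ffunE => /andP[-> _].
split; first by rewrite eGK card_lift_face.
(* Only an inclusion is available here, since [r] and [r'] may disagree on [G :&: F]. *)
- apply: subset_trans (_ : lift_face r' (G :\: F) \subset _).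
    by rewrite eGK lift_faceS.
  apply/subsetP=> _ /imsetP[i + ->]; rewrite !inE !mem_lift_face_vtx eqxx.
  by case/andP=> /negPf-> ->.
rewrite lift_faceD => [|i]; last by rewrite inE ffunE => /andP[_ ->].
rewrite (@eq_lift_face _ r) ?lift_faceS // => i.
by rewrite inE ffunE => /andP[/negPf-> _].
Qed.

(** The merged choice follows [r] at [a] and [r'] elsewhere, so the exchange trades the single
    vertex [vtx (r' a)] for [vtx (r a)]. *)
Lemma exchange_lift_face_choice r r' F a : a \in F -> r a != r' a ->
  exchange (lift_face r F) (lift_face r' F)
           (lift_face (merge_choice [set a] r r') F).
Proof.
move=> aF neq.
have eD : lift_face r' F :\: lift_face (merge_choice [set a] r r') F
    = [set vtx (r' a)].
  apply/setP=> v; rewrite !inE; apply/andP/eqP=> [[nv /imsetP[i iF ev]] | ->].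
    move: nv; rewrite ev mem_lift_face_vtx iF ffunE inE /=.
    by have [-> | ] := eqVneq i a; rewrite ?eqxx.
  by rewrite !mem_lift_face_vtx aF ffunE inE !eqxx eq_sym.
split; first by rewrite eD cards1.
- rewrite eD sub1set inE !mem_lift_face_vtx aF eqxx.
  by rewrite eq_sym (negPf neq).
apply/subsetP=> v; rewrite inE => /andP[+ /imsetP[i iF ev]].
rewrite {}ev !mem_lift_face_vtx iF ffunE inE /=.
by have [-> | _] := eqVneq i a; rewrite ?eqxx.
Qed.

Lemma weight_merge_choice r r' F a : a \in F -> r a < r' a ->
  weight (lift_face (merge_choice [set a] r r') F) < weight (lift_face r' F).
Proof.
move=> aF lta; rewrite !weight_lift_face !(bigD1 a aF) /= ffunE inE eqxx.
rewrite -addSn leq_add //; apply: leq_sum => i /andP[_ /negPf nia].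
by rewrite ffunE inE nia.
Qed.

(** Otherwise [r' <= r] pointwise on [F]; the weight inequality then forces equality in every term,
    and the two lifts coincide. *)
Lemma weight_le_exists_lt r r' F :
    lift_face r F != lift_face r' F ->
    weight (lift_face r F) <= weight (lift_face r' F) ->
  exists2 a, a \in F & r a < r' a.
Proof.
move=> neq lew; apply/exists_inP; apply: contraNT neq => noa.
have ler i : i \in F -> r' i <= r i ?= iff (r' i == r i).
  move=> iF; split=> //; rewrite leqNgt.
  by apply: contra noa => lti; apply/exists_inP; exists i.
have := leqif_sum ler; rewrite -!weight_lift_face => -[lew' eqw].
apply/eqP/eq_lift_face => i iF; apply/eqP; rewrite eq_sym.
by move: i iF; apply/forall_inP; rewrite -eqw eqn_leq lew' lew.
Qed.

Variable D : simplicial_complex 'I_n.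

Lemma facets_expansionP H :
  reflect (exists r, exists2 F, F \in facets D & H = lift_face r F)
          (H \in facets (expansion s D)).
Proof.
rewrite facets_expansion inE; apply: (iffP exists_inP).
  by case=> F FD /existsP[r /eqP->]; exists r, F.
by case=> r [F FD ->]; exists F => //; apply/existsP; exists r.
Qed.

Lemma lift_face_facet r F :
  F \in facets D -> lift_face r F \in facets (expansion s D).
Proof. by move=> FD; apply/facets_expansionP; exists r, F. Qed.

Definition max_weight := weight [set: vertex].

Lemma weight_max H : weight H <= max_weight.
Proof.
rewrite /max_weight /weight [leqRHS](big_setID H) setTI /=; exact: leq_addr.
Qed.

(* Encodes the lexicographic order on the pair (rank of the base, weight). *)
Definition expansion_rank (rk : {set 'I_n} -> nat) H :=
  rk [set tag v | v in H] * max_weight.+1 + weight H.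

(** One unit of base rank contributes [max_weight.+1], more than any weight. *)
Lemma expansion_rank_lt rk r r' F G : rk F < rk G ->
  expansion_rank rk (lift_face r F) < expansion_rank rk (lift_face r' G).
Proof.
move=> ltFG; rewrite /expansion_rank !tag_lift_face.
apply: leq_trans (leq_addr _ _); apply: leq_trans (leq_mul ltFG (leqnn _)).
by rewrite mulSn addnC ltn_add2r ltnS weight_max.
Qed.

Lemma shelling_rank_expansion rk :
  shelling_rank D rk -> shelling_rank (expansion s D) (expansion_rank rk).
Proof.
move=> rkP H H' /facets_expansionP[r [F FD ->]].
move=> /facets_expansionP[r' [G GD ->]] neq le_rank.
(* Over a common base, lower one index; over distinct bases, lift the exchange facet of the
   bases. *)
have [eFG | neFG] := eqVneq F G.
  move: neq le_rank; rewrite -{}eFG {1}/expansion_rank !tag_lift_face.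
  rewrite /expansion_rank tag_lift_face leq_add2l => neq lew.
  have [a aF lta] := weight_le_exists_lt neq lew.
  exists (lift_face (merge_choice [set a] r r') F); split.
  - exact: lift_face_facet.
  - by rewrite !tag_lift_face ltn_add2l weight_merge_choice.
  - by apply: exchange_lift_face_choice; rewrite // -val_eqE /= ltn_eqF.
have [|K [KD ltK exK]] := rkP F G FD GD neFG.
  rewrite leqNgt; apply: contraL le_rank => ltGF.
  by rewrite -ltnNge expansion_rank_lt.
exists (lift_face (merge_choice G r' r) K); split.
- exact: lift_face_facet.
- exact: expansion_rank_lt.
- exact: exchange_lift_face_base.
Qed.

Lemma shelling_rank_base r rk : shelling_rank (expansion s D) rk ->
  shelling_rank D (fun F => rk (lift_face r F)).
Proof.
move=> rkP F G FD GD neFG leFG.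
have [|H [/facets_expansionP[r' [K KD ->]] ltK [cGK sGK sKG]]] :=
  rkP _ _ (lift_face_facet r FD) (lift_face_facet r GD) _ leFG.
  by apply: contra neFG => /eqP e; rewrite -(tag_lift_face r F) e tag_lift_face.
(* Each vertex of the exchange facet lies in the lift of [G] or of [F], both made with [r], so [r']
   agrees with [r] on [K]. *)
have eK : lift_face r' K = lift_face r K.
  apply: eq_lift_face => i iK; have := subsetP sKG (vtx (r' i)).
  rewrite inE !mem_lift_face_vtx iK eqxx andbT.
  have [-> // | ne] := eqVneq (r' i) (r i).
  by rewrite !andbF => /(_ isT).
rewrite {}eK in ltK cGK sGK sKG; exists K; split=> //.
move: cGK sGK sKG; rewrite !lift_faceD // card_lift_face !lift_faceS.
by split.
Qed.

End LiftFace.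

Theorem theorem2p18 (n : nat) (Delta : simplicial_complex 'I_n)
    (s : 'I_n -> nat) (s_gt0 : forall i : 'I_n, 0 < s i) :
  strongly_shellable Delta <-> strongly_shellable (expansion s Delta).
Proof.
split=> /strongly_shellableP[rk rkP]; apply/strongly_shellableP.
  by exists (expansion_rank rk); apply: shelling_rank_expansion.
(* Positivity provides index 0 over every vertex, and these vertices form the fixed copy of the
   vertex set. *)
exists (fun F => rk (lift_face [ffun i => Ordinal (s_gt0 i)] F)).
exact: shelling_rank_base.
Qed.
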